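(* Let $w_n = Pw_{n-1}+\triangle t_n Q_nF(w_{n-1})+\triangle t_n RF(w_n)$, $n\ge 1$, be an $s$-stage implicit Peer method with variable step sizes (as described in the context) having stage order $s$, and suppose that the global error $\varepsilon_n=w(t_n)-w_n$ satisfies the estimate $$\|\varepsilon_n\|\le K\|\varepsilon_0\|+K\left(\triangle t_1^{s+1}\|d_{1,s+1}\|_\infty+\ldots+\triangle t_n^{s+1}\|d_{n,s+1}\|_\infty\right)\max_{0\le t\le t_n}\|u^{(s+1)}(t)\|+\mathcal{O}(\triangle t_{max}^{s+1})$$ with $\|\varepsilon_0\|=\mathcal{O}(\triangle t_0^{s+1})$. Let $\triangle t_{i-1}=(1+\mathcal{O}(\triangle t_{max}))\triangle t_i$ for all $i=1,\ldots,n$. Then the method is convergent of order $p=s+1$, i.e., $\varepsilon_n=\mathcal{O}(\triangle t_{max}^{s+1})$, if for all $v\in\mathbb{R}^s$ with $(I-P^T)v=0$ the following conditions are satisfied: $$v^T(C-I)V_1\tilde{D}V_1^{-1}(c-e)^s=0,$$ $$v^T\left(c^j-jRc^{j-1}\right)=0,\qquad j=2,\ldots,s+1.$$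
   Context: Problem: $u'(t)=F(u(t))$, $u(0)=u_0\in\mathbb{R}^m$, on a fixed bounded time interval, with $F:\mathbb{R}^m\to\mathbb{R}^m$ and the solution $u$ sufficiently smooth. Grid: step sizes $\triangle t_n>0$, $t_0=0$, $t_n=\triangle t_0+\ldots+\triangle t_{n-1}$, step size ratios $\sigma_n=\triangle t_n/\triangle t_{n-1}$ with $0\le\sigma_{min}<\sigma_n<\sigma_{max}$, and $\triangle t_{max}=\max_{i=0,\ldots,n}\triangle t_i$. All $\mathcal{O}$-constants are uniform in $n$ (for $t_n$ in the bounded time interval), in $i$ and in the step sizes, as $\triangle t_{max}\to 0$. Method: $w_n=[w_{n,1}^T,\ldots,w_{n,s}^T]^T\in\mathbb{R}^{ms}$ with $w_{n,i}\approx u(t_n+c_i\triangle t_n)$; the nodes $c_i\in\mathbb{R}$ are pairwise distinct and $c_s=1$; $F(w)=[F(w_i)]$ is applied componentwise. An $s\times s$ matrix $A$ acting on $\mathbb{R}^{ms}$ means $A\otimes I_m$. $P,R$ are constant $s\times s$ matrices, $R$ lower triangular with constant diagonal $r_{ii}=\gamma>0$. The exact values are $w(t_n)=[u(t_n+c_i\triangle t_n)]_{i=1}^s$. Notation: $e=(1,\ldots,1)^T$, $c=(c_1,\ldots,c_s)^T$, powers of vectors are componentwise (with $0^0=1$), $V_0=(c_i^{j-1})_{i,j=1}^s$, $V_1=((c_i-1)^{j-1})_{i,j=1}^s$, $C=\mathrm{diag}(c_1,\ldots,c_s)$, $D=\mathrm{diag}(1,2,\ldots,s)$, $\tilde D=(s+1)D^{-1}-I$,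 $S_n=\mathrm{diag}(1,\sigma_n,\ldots,\sigma_n^{s-1})$. The matrix $Q_n$ is $$Q_n=\left((CV_0-RV_0D)S_n-\tfrac{1}{\sigma_n}P(C-I)V_1\right)(V_1D)^{-1}.$$ Defect coefficients: $$d_{n,j}=\frac{1}{j!}\left(c^j-\frac{1}{\sigma_n^j}P(c-e)^j-\frac{j}{\sigma_n^{j-1}}Q_n(c-e)^{j-1}-jRc^{j-1}\right).$$ The method has stage order $q$ if it is pre-consistent ($Pe=e$) and $d_{n,j}=0$ for all $\sigma_n$ and $j=1,\ldots,q$. Standing stability assumption (with $K$ a constant independent of $n$ and the step sizes): products of the transfer matrices of the error recursion are bounded by $K$, in the sense that there is a fixed $\rho_0>0$ such that, for all sequences $\tilde w_i\in\mathbb{R}^{ms}$ with $\|\tilde w_i-w(t_i)\|\le\rho_0$ and residuals $\rho_i=\tilde w_i-P\tilde w_{i-1}-\triangle t_iQ_iF(\tilde w_{i-1})-\triangle t_iRF(\tilde w_i)$, $i\ge 1$, one has $\|\tilde w_n-w_n\|\le K(\|\tilde w_0-w_0\|+\|\rho_1\|+\ldots+\|\rho_n\|)$. *)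

(* Defs.v *)
From HB Require Import structures.
From mathcomp Require Import all_boot all_order all_algebra.
From mathcomp Require Import all_classical all_reals all_analysis.

Set Implicit Arguments.
Unset Strict Implicit.
Unset Printing Implicit Defensive.

Import Order.TTheory GRing.Theory Num.Theory.
Import numFieldNormedType.Exports.

Local Open Scope ring_scope.
Local Open Scope classical_set_scope.

(* An element of R^(m s) is an s x m matrix whose i-th row is the (transposed)
   i-th stage, so that A (x) I_m acts as [A *m _]. Vectors and matrices are
   0-indexed: the entry (i, j) of V_0 is c_i ^ j, that of D is j + 1, etc. *)

Definition is_norm (R : realType) (V : lmodType R) (N : V -> R) : Prop :=
  [/\ forall x y, N (x + y) <= N x + N y,
      forall (a : R) x, N (a *: x) = `|a| * N x
    & forall x, N x = 0 -> x = 0].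

(** Coefficients of the method *)

Definition ones (R : realType) (s : nat) : 'cV[R]_s := const_mx 1.

Definition vpow (R : realType) (s : nat) (c : 'cV[R]_s) (j : nat) : 'cV[R]_s :=
  \col_i c i 0 ^+ j.

Definition V0 (R : realType) (s : nat) (c : 'cV[R]_s) : 'M[R]_s :=
  \matrix_(i, j) c i 0 ^+ j.

Definition V1 (R : realType) (s : nat) (c : 'cV[R]_s) : 'M[R]_s :=
  \matrix_(i, j) (c i 0 - 1) ^+ j.

Definition Cmx (R : realType) (s : nat) (c : 'cV[R]_s) : 'M[R]_s :=
  diag_mx c^T.

Definition Dmx (R : realType) (s : nat) : 'M[R]_s :=
  diag_mx (\row_j j.+1%:R).

Definition Dtilde (R : realType) (s : nat) : 'M[R]_s :=
  s.+1%:R *: invmx (Dmx R s) - 1%:M.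

Definition Smx (R : realType) (s : nat) (sigma : R) : 'M[R]_s :=
  diag_mx (\row_j sigma ^+ j).

Definition Qmx (R : realType) (s : nat) (Pm Rm : 'M[R]_s) (c : 'cV[R]_s)
    (sigma : R) : 'M[R]_s :=
  ((Cmx c *m V0 c - Rm *m V0 c *m Dmx R s) *m Smx s sigma
    - sigma^-1 *: (Pm *m (Cmx c - 1%:M) *m V1 c)) *m invmx (V1 c *m Dmx R s).

(* Only meaningful for j >= 1. *)
Definition defect (R : realType) (s : nat) (Pm Rm : 'M[R]_s) (c : 'cV[R]_s)
    (sigma : R) (j : nat) : 'cV[R]_s :=
  (j`!%:R)^-1 *:
    (vpow c j
     - (sigma ^+ j)^-1 *: (Pm *m vpow (c - ones R s) j)
     - (j%:R / sigma ^+ j.-1) *: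
         (Qmx Pm Rm c sigma *m vpow (c - ones R s) j.-1)
     - j%:R *: (Rm *m vpow c j.-1)).

Definition stage_order (R : realType) (s : nat) (smin smax : R)
    (Pm Rm : 'M[R]_s) (c : 'cV[R]_s) (q : nat) : Prop :=
  Pm *m ones R s = ones R s /\
  forall sigma : R, smin < sigma < smax ->
    forall j : nat, (1 <= j <= q)%N -> defect Pm Rm c sigma j = 0.

(** Grids *)

Definition gtime (R : realType) (dt : nat -> R) (n : nat) : R :=
  \sum_(i < n) dt i.

(* Step size ratio, for n >= 1. *)
Definition gratio (R : realType) (dt : nat -> R) (n : nat) : R :=
  dt n / dt n.-1.

(* The steps are positive, so the neutral element 0 is harmless. *)
Definition dtmax (R : realType) (dt : nat -> R) (n : nat) : R :=
  \big[Num.max/0]_(i < n.+1) dt i.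

(* [small_steps dt T A] : A holds at all grid points t_n <= T of all the grids
   of the family dt, as soon as the largest step is below a threshold h0 common
   to the whole family. "x = O(y) as dtmax -> 0, uniformly in n and in the step
   sizes" is [exists L, small_steps dt T (fun k n => `|x k n| <= L * y k n)]. *)
Definition small_steps (R : realType) (I : Type) (dt : I -> nat -> R) (T : R)
    (A : I -> nat -> Prop) : Prop :=
  exists2 h0 : R, 0 < h0 &
    forall (k : I) (n : nat), gtime (dt k) n <= T -> dtmax (dt k) n <= h0 ->
      A k n.

(** Differential equation *)

Definition cont_diff (R : realType) (m : nat) (F : 'rV[R]_m -> 'rV[R]_m) :
    Prop :=
  (forall x, differentiable F x) /\
  (forall v : 'rV[R]_m, continuous (fun x => 'd F x v : 'rV[R]_m)).

Definition Ck_on (R : realType) (m : nat) (a b : R) (k : nat)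
    (u : R -> 'rV[R]_m) : Prop :=
  (forall (j : nat) (t : R), (j < k)%N -> a < t < b -> derivable u^`(j) t 1) /\
  (forall t : R, a < t < b -> {for t, continuous u^`(k)}).

Definition solves (R : realType) (m : nat) (F : 'rV[R]_m -> 'rV[R]_m)
    (a b : R) (u : R -> 'rV[R]_m) : Prop :=
  forall t : R, a < t < b -> is_derive t 1 u (F (u t)).

(** Peer method *)

Definition Fstages (R : realType) (s m : nat) (F : 'rV[R]_m -> 'rV[R]_m)
    (w : 'M[R]_(s, m)) : 'M[R]_(s, m) :=
  \matrix_(i < s) F (row i w).

Definition exact_stages (R : realType) (s m : nat) (u : R -> 'rV[R]_m)
    (c : 'cV[R]_s) (dt : nat -> R) (n : nat) : 'M[R]_(s, m) :=
  \matrix_(i < s) u (gtime dt n + c i 0 * dt n).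

(* Right-hand side of the n-th step of the method, for n >= 1. *)
Definition peer_rhs (R : realType) (s m : nat) (F : 'rV[R]_m -> 'rV[R]_m)
    (Pm Rm : 'M[R]_s) (c : 'cV[R]_s) (dt : nat -> R)
    (w : nat -> 'M[R]_(s, m)) (n : nat) : 'M[R]_(s, m) :=
  Pm *m w n.-1
  + dt n *: (Qmx Pm Rm c (gratio dt n) *m Fstages F (w n.-1))
  + dt n *: (Rm *m Fstages F (w n)).

Definition peer_residual (R : realType) (s m : nat) (F : 'rV[R]_m -> 'rV[R]_m)
    (Pm Rm : 'M[R]_s) (c : 'cV[R]_s) (dt : nat -> R)
    (w : nat -> 'M[R]_(s, m)) (n : nat) : 'M[R]_(s, m) :=
  w n - peer_rhs F Pm Rm c dt w n.

Definition global_error (R : realType) (s m : nat) (u : R -> 'rV[R]_m)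
    (c : 'cV[R]_s) (dt : nat -> R) (w : nat -> 'M[R]_(s, m)) (n : nat) :
    'M[R]_(s, m) :=
  exact_stages u c dt n - w n.

(* [w] is a family of numerical solutions, [w k] being computed on the grid
   [dt k]; K and rho0 are common to the whole family. *)
Definition peer_stable (R : realType) (s m : nat) (N : 'M[R]_(s, m) -> R)
    (F : 'rV[R]_m -> 'rV[R]_m) (u : R -> 'rV[R]_m) (Pm Rm : 'M[R]_s)
    (c : 'cV[R]_s) (I : Type) (dt : I -> nat -> R)
    (w : I -> nat -> 'M[R]_(s, m)) (T K : R) : Prop :=
  exists2 rho0 : R, 0 < rho0 &
    small_steps dt T (fun k n => forall wt : nat -> 'M[R]_(s, m),
      (forall i, (i <= n)%N -> N (wt i - exact_stages u c (dt k) i) <= rho0) ->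
      N (wt n - w k n) <=
        K * (N (wt 0%N - w k 0%N)
             + \sum_(1 <= i < n.+1) N (peer_residual F Pm Rm c (dt k) wt i))).

(* NR is the norm on R^m. The supremum is a maximum: u^(s+1) is continuous. *)
Definition error_estimate (R : realType) (s m : nat) (N : 'M[R]_(s, m) -> R)
    (NR : 'rV[R]_m -> R) (u : R -> 'rV[R]_m) (Pm Rm : 'M[R]_s) (c : 'cV[R]_s)
    (I : Type) (dt : I -> nat -> R) (w : I -> nat -> 'M[R]_(s, m)) (T K : R) :
    Prop :=
  exists L : R, small_steps dt T (fun k n =>
    N (global_error u c (dt k) (w k) n) <=
      K * N (global_error u c (dt k) (w k) 0%N)
      + K * (\sum_(1 <= i < n.+1)
               dt k i ^+ s.+1 * `|defect Pm Rm c (gratio (dt k) i) s.+1|)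
          * sup [set NR (u^`(s.+1) t) | t in `[0, gtime (dt k) n]]
      + L * dtmax (dt k) n ^+ s.+1).

Definition convergent_of_order (R : realType) (s m : nat)
    (N : 'M[R]_(s, m) -> R) (u : R -> 'rV[R]_m) (c : 'cV[R]_s) (I : Type)
    (dt : I -> nat -> R) (w : I -> nat -> 'M[R]_(s, m)) (T : R) (p : nat) :
    Prop :=
  exists L : R, small_steps dt T (fun k n =>
    N (global_error u c (dt k) (w k) n) <= L * dtmax (dt k) n ^+ p).

(* Main.v *)
(* The defect d(sigma) of order s+1 is a Lipschitz function of the step size
   ratio sigma near 1, and ratios are 1 + O(dtmax), so it may be replaced by
   d = d(1). The order conditions say that d is orthogonal to the kernel of
   I - P^T, hence d = (I - P) g for some g. For the corrected exact values
   w~_i = w(t_i) - dt_i^(s+1) g u^(s+1)(t_i), the leading residual term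
   dt_i^(s+1) d u^(s+1)(t_i) then cancels and the residuals are
   O(dt_i dtmax^(s+1)). They sum up to O(dtmax^(s+1)), and the stability
   assumption applied to w~ gives the result. *)
Require Import Defs.
From HB Require Import structures.
From mathcomp Require Import all_boot all_order all_algebra.
From mathcomp Require Import all_classical all_reals all_analysis.
From mathcomp Require Import ring lra.

Set Implicit Arguments.
Unset Strict Implicit.
Unset Printing Implicit Defensive.

Import Order.TTheory GRing.Theory Num.Theory.
Import numFieldNormedType.Exports.

Local Open Scope ring_scope.
Local Open Scope classical_set_scope.

(** * Vector-valued calculus *)

(** The vector d(1) need not vanish, so taking norms of the defects and summing would leave only
    order s. The cancellation must happen inside each residual, before norms are taken; this is why
    stability is applied to modified exact values. The modification is itself O(dtmax^(s+1)), so
    undoing it at the end is harmless, and inside F it is damped by an extra step size. The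
    correction at step i - 1 carries dt_(i-1) and u^(s+1)(t_(i-1)). Replacing them by their values
    at step i costs dt_i^(s+1) - dt_(i-1)^(s+1), a second use of ratios close to 1, and an increment
    of u^(s+1), which calls for s + 2 derivatives. Step thresholds keep the modified values within
    rho0 of the exact ones and inside a ball on which the C^1 function F is Lipschitz. *)

Lemma mx_norm_leP (R : realType) (m n : nat) (A : 'M[R]_(m, n)) (B : R) :
  0 <= B -> (`|A| <= B) <-> (forall i j, `|A i j| <= B).
Proof.
move=> B0; rewrite {1}/Num.norm /= mx_normrE; split=> [/bigmax_leP[_ h] i j|h].
  exact: (h (i, j)).
by apply/bigmax_leP; split=> // -[i j] _; exact: h.
Qed.

Lemma mx_entry_le (R : realType) (m n : nat) (A : 'M[R]_(m, n)) i j :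
  `|A i j| <= `|A|.
Proof. by have /(mx_norm_leP A) := normr_ge0 A; rewrite lexx => -[/(_ isT)]. Qed.

Lemma mulmx_norm_le (R : realType) (m n p : nat) (A : 'M[R]_(m, n))
    (B : 'M[R]_(n, p)) : `|A *m B| <= n%:R * (`|A| * `|B|).
Proof.
apply/mx_norm_leP => [|i j]; first by rewrite !mulr_ge0.
rewrite mxE (le_trans (ler_norm_sum _ _ _))//.
apply: le_trans (_ : \sum_(k < n) `|A| * `|B| <= _).
  by apply: ler_sum => k _; rewrite normrM ler_pM ?mx_entry_le.
by rewrite sumr_const card_ord mulr_natl.
Qed.

Lemma is_norm_ge0 (R : realType) (V : lmodType R) (N : V -> R) (x : V) :
  is_norm N -> 0 <= N x.
Proof.
case=> NT NZ _; have := NT x (- x).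
rewrite subrr -(scale0r x) -scaleN1r !NZ normr0 mul0r normrN1 mul1r.
by rewrite -mulr2n pmulrn_lge0.
Qed.

(** The residuals are estimated in the max norm; this passes the bounds to the arbitrary norm N, by
    expansion in unit matrices. The added 1 keeps the constant positive in dimension zero too. *)
Lemma norm_le_mx_norm (R : realType) (m n : nat) (N : 'M[R]_(m, n) -> R) :
  is_norm N -> exists2 CN : R, 0 < CN & forall A, N A <= CN * `|A|.
Proof.
move=> N_norm; have [NT NZ _] := N_norm.
have N_0 : N 0 = 0 by rewrite -(scale0r (0 : 'M[R]_(m, n))) NZ normr0 mul0r.
have NS (r : seq ('I_m * 'I_n)) (f : 'I_m * 'I_n -> 'M[R]_(m, n)) :
    N (\sum_(i <- r) f i) <= \sum_(i <- r) N (f i).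
  elim: r => [|i r IH]; first by rewrite !big_nil N_0.
  by rewrite !big_cons (le_trans (NT _ _))// lerD2l.
exists (1 + \sum_(ij : 'I_m * 'I_n) N (delta_mx ij.1 ij.2)) => [|A].
  by rewrite ltr_pwDl// sumr_ge0// => *; apply: is_norm_ge0.
rewrite mulrDl mul1r {1}[A]matrix_sum_delta.
rewrite pair_big /= (le_trans (NS _ _))// mulr_suml.
apply: le_trans (_ : \sum_(ij : 'I_m * 'I_n) N (delta_mx ij.1 ij.2) * `|A| <= _).
  apply: ler_sum => ij _; rewrite NZ mulrC.
  by rewrite (ler_wpM2l (is_norm_ge0 _ N_norm))// mx_entry_le.
by rewrite lerDr normr_ge0.
Qed.

Lemma mean_value_between (R : realType) (f df : R -> R) (a b x y : R) :
  (forall z, z \in `[a, b]%R -> is_derive z 1 f (df z)) ->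
  x \in `[a, b]%R -> y \in `[a, b]%R -> x <= y ->
  exists z, [/\ z \in `[a, b]%R, x <= z <= y
               & f y - f x = df z * (y - x)].
Proof.
rewrite !in_itv /= => dff /andP[ax _] /andP[_ yb] xy.
have xy_ab z : z \in `[x, y]%R -> z \in `[a, b]%R.
  rewrite !in_itv /= => /andP[xz zy].
  by rewrite (le_trans ax xz) (le_trans zy yb).
have dff_oo z : z \in `]x, y[%R -> is_derive z 1 f (df z).
  by move=> zxy; apply/dff/xy_ab; apply: subset_itv_oo_cc.
have cf : {within `[x, y], continuous f}.
  apply: derivable_within_continuous => z zxy.
  by have [] := dff z (xy_ab z zxy).
have [z zxy E] := MVT_segment xy dff_oo cf.
by exists z; split=> //; exact: xy_ab.
Qed.

(** For the max norm the scalar mean value theorem applies entry by entry, with a separate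
    intermediate point for each. Bounding f' only at points no farther from x than y lets the bound
    depend on |y - x|, as the Taylor induction requires. *)
Lemma mean_value_ineq (R : realType) (m : nat) (f : R -> 'rV[R]_m)
    (a b x y B : R) :
  (forall z, z \in `[a, b]%R -> derivable f z 1) ->
  x \in `[a, b]%R -> y \in `[a, b]%R ->
  (forall z, z \in `[a, b]%R -> `|z - x| <= `|y - x| -> `|f^`() z| <= B) ->
  `|f y - f x| <= B * `|y - x|.
Proof.
move=> df xab yab dfB.
have B0 : 0 <= B.
  by apply: le_trans (dfB x xab _); rewrite ?normr_ge0// subrr normr0.
apply/mx_norm_leP => [|i j]; first by rewrite mulr_ge0.
pose g t := f t i j; pose dg t := f^`() t i j.
have dfz z : z \in `[a, b]%R -> is_derive z 1 g (dg z).
  move=> zab; have dz := df z zab; apply: DeriveDef.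
    by move/derivable_mxP: dz; apply.
  by rewrite /dg derive1E derive_mx// mxE.
have dgB z : z \in `[a, b]%R -> `|z - x| <= `|y - x| -> `|dg z| <= B.
  by move=> zab zx; rewrite (le_trans (mx_entry_le _ _ _))// dfB.
rewrite !mxE -/(g y) -/(g x).
move: g dg dfz dgB => {df dfB} g dg dfz dgB.
have [xy|/ltW yx] := leP x y.
  have [z [zab /andP[xz zy] ->]] := mean_value_between dfz xab yab xy.
  by rewrite normrM ler_wpM2r// dgB// !ger0_norm ?subr_ge0// lerB.
have [z [zab /andP[yz zx] E]] := mean_value_between dfz yab xab yx.
rewrite distrC E normrM [`|x - y|]distrC ler_wpM2r// dgB//.
by rewrite !ler0_norm ?subr_le0// !opprB lerB.
Qed.

Lemma is_derive_scalel (R : realType) (V : normedModType R) (k : R -> R)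
    (v : V) (x dk : R) :
  is_derive x 1 k dk -> is_derive x 1 (fun z => k z *: v) (dk *: v).
Proof.
move=> [dk1 dk2].
have dkx : differentiable k x by apply/derivable1_diffP.
have dkv := @differentiableZl _ _ _ k v x dkx.
apply: DeriveDef; first exact/derivable1_diffP.
by rewrite deriveE// diffZl// -deriveE// dk2.
Qed.

(** Induction on k: the remainder vanishes at t and its derivative is the remainder of u' with one
    term fewer, so the mean value inequality adds a factor |y - t|. Nothing is integrated, hence no
    1/k! in the bound. *)
Lemma taylor_ineq (R : realType) (m k : nat) (u : R -> 'rV[R]_m) (a b M : R) :
  (forall j z, (j < k)%N -> z \in `[a, b]%R -> derivable u^`(j) z 1) ->
  (forall z, z \in `[a, b]%R -> `|u^`(k) z| <= M) ->
  forall t y, t \in `[a, b]%R -> y \in `[a, b]%R ->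
  `|u y - \sum_(j < k) ((y - t) ^+ j / j`!%:R) *: u^`(j)%classic t|
    <= M * `|y - t| ^+ k.
Proof.
elim: k u => [|k IH] u du uM t y tab yab.
  by rewrite big_ord0 subr0 expr0 mulr1; apply: uM.
pose r z := u z - \sum_(j < k.+1) ((z - t) ^+ j / j`!%:R) *: u^`(j)%classic t.
have dr z : z \in `[a, b]%R -> is_derive z 1 r
    (u^`()%classic z - \sum_(j < k) ((z - t) ^+ j / j`!%:R) *: u^`(j.+1)%classic t).
  move=> zab; apply: is_deriveB.
    by rewrite derive1E; apply: derivableP; apply: (du 0%N).
  pose g j : R -> 'rV[R]_m := fun z => ((z - t) ^+ j / j`!%:R) *: u^`(j)%classic t.
  have dg (j : 'I_k.+1) : is_derive z 1 (g j)
      ((j%:R * (z - t) ^+ j.-1 / j`!%:R) *: u^`(j)%classic t).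
    apply: is_derive_scalel.
    rewrite (_ : (fun z => _) = (fun z => j`!%:R^-1 * (z - t) ^+ j)).
      have dB : is_derive z 1 (fun x : R => x - t) 1.
        by rewrite -[X in is_derive _ _ _ X]subr0; apply: is_deriveB.
      have dX : is_derive z 1 (fun x : R => (x - t) ^+ j)
          (j%:R * (z - t) ^+ j.-1).
        have := @is_deriveX _ _ _ j _ _ _ dB.
        rewrite (_ : (_ ^+ j) = (fun x : R => (x - t) ^+ j)).
          by rewrite /GRing.scale /= mulr1.
        by apply/funext => x; rewrite exprfctE.
      have := @is_deriveZ _ _ _ _ (j`!%:R^-1) _ _ _ dX.
      by rewrite /GRing.scale /= mulrC.
    by apply/funext => x; rewrite mulrC.
  rewrite (_ : (fun z => _) = \sum_(j < k.+1) g j); last first.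
    by apply/funext => x; rewrite fct_sumE.
  apply: is_derive_eq.
  rewrite big_ord_recl /= mul0r mul0r scale0r add0r.
  apply: eq_bigr => j _; rewrite /bump /= add1n /= factS natrM invfM.
  congr (_ *: _); field.
  by rewrite ?[1 + _]addrC ?natr1 !pnatr_eq0 -?lt0n ?fact_gt0.
have rt : r t = 0.
  rewrite /r big_ord_recl /= expr0 fact0 divr1 scale1r big1 ?addr0 ?subrr//.
  by move=> j _; rewrite expr0n /= mul0r scale0r.
rewrite -/(r y) -[r y]subr0 -rt exprSr mulrA.
apply: (@mean_value_ineq _ _ _ a b) => // [z zab|z zab zy].
  by have [] := dr z zab.
rewrite derive1E; have [_ ->] := dr z zab.
have := IH u^`() _ _ t z tab zab.
under eq_bigr do rewrite -derive1Sn.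
move=> /(_ _ _)/le_trans -> //.
- by move=> j x jk xab; rewrite -derive1Sn; apply: du.
- by move=> x xab; rewrite -derive1Sn; apply: uM.
rewrite ler_wpM2l ?lerXn2r// ?nnegrE//.
by apply: le_trans (uM t tab); apply: normr_ge0.
Qed.

Lemma continuous_norm_bounded (R : realType) (T : topologicalType)
    (V : normedModType R) (f : T -> V) (A : set T) :
  compact A -> (forall x, A x -> {for x, continuous f}) ->
  exists2 M, 0 <= M & forall x, A x -> `|f x| <= M.
Proof.
move=> cA cf.
have cwf : {within A, continuous f}.
  by apply: continuous_in_subspaceT => x; rewrite inE; apply: cf.
have [M [_ fM]] := compact_bounded (continuous_compact cwf cA).
exists (Num.max 0 (M + 1)) => [|x Ax]; rewrite le_max ?lexx//.
by rewrite [X in _ || X]fM ?orbT// ?ltrDl//; exists x.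
Qed.

(** F is only C^1, so the estimate lives on a ball: compactness bounds F', and convexity keeps the
    segment from y to x inside. Continuity of F' is given direction by direction, hence the detour
    through the basis vectors [delta_mx 0 k]. *)
Lemma cont_diff_lipschitz (R : realType) (m : nat) (F : 'rV[R]_m -> 'rV[R]_m)
    (B : R) : cont_diff F ->
  exists2 L, 0 <= L &
    forall x y, `|x| <= B -> `|y| <= B -> `|F x - F y| <= L * `|x - y|.
Proof.
move=> [dF cdF].
have cB : compact [set x : 'rV[R]_m | `|x| <= B].
  apply: bounded_closed_compact.
    by exists B; split=> [|M BM x /le_trans]; [exact: num_real|apply; exact: ltW].
  apply: (@closed_comp _ _ (fun x : 'rV[R]_m => `|x|) [set r | r <= B]).
    by move=> x _; exact: norm_continuous.
  exact: closed_le.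
have /choice[M dM] (k : 'I_m) : exists M, 0 <= M /\
    forall x, `|x| <= B -> `|'d F x (delta_mx 0 k) : 'rV[R]_m| <= M.
  have [M M0 MP] := continuous_norm_bounded cB (fun x _ => cdF (delta_mx 0 k) x).
  by exists M; split.
exists (\sum_k M k) => [|x y xB yB].
  by apply: sumr_ge0 => k _; have [] := dM k.
have dFB z v : `|z| <= B -> `|'d F z v : 'rV[R]_m| <= (\sum_k M k) * `|v|.
  move=> zB; rewrite {1}[v]row_sum_delta linear_sum mulr_suml.
  apply: le_trans (ler_norm_sum _ _ _) _; apply: ler_sum => k _.
  rewrite linearZ normrZ mulrC ler_pM ?mx_entry_le//.
  by have [_] := dM k; apply.
pose g (t : R) : 'rV[R]_m := y + t *: (x - y).
have gB t : t \in `[0, 1]%R -> `|g t| <= B.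
  rewrite in_itv /= => /andP[t0 t1].
  have -> : g t = t *: x + (1 - t) *: y.
    by rewrite /g scalerBr scalerBl scale1r addrCA.
  rewrite (le_trans (ler_normD _ _))// !normrZ !ger0_norm ?subr_ge0//.
  have -> : B = t * B + (1 - t) * B by ring.
  by rewrite lerD// ler_wpM2l// subr_ge0.
have dg (t : R) : is_derive t 1 g (x - y).
  rewrite -[X in is_derive _ _ _ X]add0r -[X in 0 + X]scale1r.
  apply: is_deriveD; exact: is_derive_scalel.
have dFg (t : R) : is_derive t 1 (F \o g) ('d F (g t) (x - y)).
  have [dgt dge] := dg t.
  have dgt' : differentiable g t by apply/derivable1_diffP.
  have dFgt := differentiable_comp dgt' (dF (g t)).
  apply: DeriveDef; first exact/derivable1_diffP.
  by rewrite deriveE// diff_comp//= -[X in 'd F _ X]deriveE// dge.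
have -> : F x = (F \o g) 1 by rewrite /g/= scale1r addrC subrK.
have -> : F y = (F \o g) 0 by rewrite /g/= scale0r addr0.
rewrite -[leRHS]mulr1 -[X in _ * X](normr1 R) -[X in _ <= _ * `|X|]subr0.
apply: (@mean_value_ineq _ _ _ 0 1); rewrite ?in_itv/= ?lexx ?ler01// => t t01.
by move=> _; rewrite derive1E; have [_ ->] := dFg t; apply/dFB/gB.
Qed.

Lemma Ck_on_derive1n_bounded (R : realType) (m k : nat) (u : R -> 'rV[R]_m)
    (a b a' b' : R) : a < a' -> b' < b -> Ck_on a b k u ->
  exists2 M, 0 <= M &
    forall j t, (j <= k)%N -> t \in `[a', b']%R -> `|u^`(j) t| <= M.
Proof.
move=> aa' bb' [du cu].
have tab t : a' <= t <= b' -> a < t < b.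
  by move=> /andP[/(lt_le_trans aa') -> /le_lt_trans ->].
have /choice[M uM] (j : 'I_k.+1) : exists M, 0 <= M /\
    forall t, t \in `[a', b']%R -> `|u^`(j) t| <= M.
  have [|M M0 uM] := @continuous_norm_bounded R R _ u^`(j) `[a', b'] (@segment_compact _ _ _).
    move=> t; rewrite /= in_itv /= => /tab tt.
    have := ltn_ord j; rewrite ltnS leq_eqVlt => /orP[/eqP ->|jk]; first exact: cu.
    by apply: differentiable_continuous; apply/derivable1_diffP; apply: du.
  by exists M; split.
exists (\sum_j M j) => [|j t jk tab'].
  by apply: sumr_ge0 => j _; have [] := uM j.
have [_ /(_ t tab')] := uM (inord j); rewrite inordK ?ltnS// => /le_trans -> //.
rewrite (bigD1 (inord j))//= lerDl sumr_ge0// => i _.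
by have [] := uM i.
Qed.

(** * Solvability of (I - P) g = d *)

Lemma V1_unit (R : realType) (s : nat) (c : 'cV[R]_s) :
  injective (fun i => c i 0) -> V1 c \in unitmx.
Proof.
move=> cI; have -> : V1 c = (Vandermonde s (\row_j (c j 0 - 1)))^T.
  by apply/matrixP => i j; rewrite !mxE.
rewrite unitmx_tr unitmxE det_Vandermonde unitfE.
apply/prodf_neq0 => i _; apply/prodf_neq0 => j ij.
rewrite !mxE opprB addrA subrK subr_eq0.
by apply: contraTneq ij => /cI ->; rewrite ltnn.
Qed.

Lemma Dmx_unit (R : realType) (s : nat) : Dmx R s \in unitmx.
Proof.
rewrite unitmxE det_diag unitfE; apply/prodf_neq0 => i _.
by rewrite mxE pnatr_eq0.
Qed.

Lemma Smx1 (R : realType) (s : nat) : Smx s (1 : R) = 1%:M.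
Proof. by apply/matrixP => i j; rewrite !mxE expr1n. Qed.

Lemma Cmx_sub1_vpow (R : realType) (s : nat) (c : 'cV[R]_s) (j : nat) :
  (Cmx c - 1%:M) *m vpow (c - ones R s) j = vpow (c - ones R s) j.+1.
Proof.
apply/matrixP => i k; rewrite mulmxBl mul1mx mul_diag_mx !mxE exprS; ring.
Qed.

Lemma col_mulmx (R : pzSemiRingType) (m n p : nat) (A : 'M[R]_(m, n))
    (B : 'M[R]_(n, p)) (j : 'I_p) : col j (A *m B) = A *m col j B.
Proof. by rewrite !colE mulmxA. Qed.

Lemma invmx_mul (R : comUnitRingType) (n : nat) (A B : 'M[R]_n) :
  A \in unitmx -> B \in unitmx -> invmx (A *m B) = invmx B *m invmx A.
Proof.
move=> uA uB; apply: (can_inj (mulKmx (_ : A *m B \in unitmx))).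
  by rewrite unitmx_mul uA.
by rewrite mulmxV ?unitmx_mul ?uA// mulmxA mulmxK// mulmxV.
Qed.

(* The order conditions omit j = 1, i.e. v^T (c - R e) = 0. That term enters
   v^T Q only as a multiple of the last unit row vector, which annihilates
   (c - e)^s because c_s = 1. *)
Lemma defect1_ortho (R : realType) (s : nat) (Pm Rm : 'M[R]_s)
    (c v : 'cV[R]_s) :
  (0 < s)%N -> injective (fun i => c i 0) ->
  (forall i : 'I_s, i.+1 = s -> c i 0 = 1) ->
  (1%:M - Pm^T) *m v = 0 ->
  v^T *m (Cmx c - 1%:M) *m V1 c *m Dtilde R s *m invmx (V1 c)
    *m vpow (c - ones R s) s = 0 ->
  (forall j : nat, (2 <= j <= s.+1)%N ->
     v^T *m (vpow c j - j%:R *: (Rm *m vpow c j.-1)) = 0) ->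
  v^T *m defect Pm Rm c 1 s.+1 = 0.
Proof.
case: s => // s in Pm Rm c v * => _ c_inj c_last vP cond1 cond2.
have vPm : v^T *m Pm = v^T.
  apply: trmx_inj; rewrite trmx_mul trmxK; apply/esym/eqP.
  by rewrite -subr_eq0 -[X in X - _]mul1mx -mulmxBl vP.
have uV := V1_unit c_inj; have uD := Dmx_unit R s.+1.
set x := vpow (c - ones R s.+1) s.+1 in cond1 *.
(* Since c_s = 1 and 0^0 = 1, the last row of V_1 is the first unit vector, and D leaves it
   unchanged; hence e_1^T (V_1 D)^(-1) = e_s^T. *)
have lastV : row ord_max (V1 c *m Dmx R s.+1) = delta_mx 0 0.
  apply/rowP => j; rewrite mxE mul_mx_diag !mxE c_last// subrr expr0n eqxx /=.
  by rewrite -val_eqE /=; case: eqP => [->|]; rewrite ?mulr1 ?mul0r.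
have firstrow : v^T *m (Cmx c *m V0 c - Rm *m V0 c *m Dmx R s.+1)
    = (v^T *m (c - Rm *m ones R s.+1)) 0 0 *: delta_mx 0 0.
  have colDE (j : 'I_s.+1) : col j (Cmx c *m V0 c - Rm *m V0 c *m Dmx R s.+1)
      = vpow c j.+1 - j.+1%:R *: (Rm *m vpow c j).
    rewrite linearB /= -mulmxA !col_mulmx scalemxAr; congr (_ - _).
      by apply/colP => i; rewrite -col_mulmx mul_diag_mx !mxE exprS.
    by congr (_ *m _); apply/colP => i; rewrite -col_mulmx mul_mx_diag !mxE mulrC.
  apply/rowP => j.
  have -> (r : 'M[R]_(s.+1, s.+1)) : (v^T *m r) 0 j = (v^T *m col j r) 0 0.
    by rewrite -col_mulmx [in RHS]mxE.
  rewrite colDE [in RHS]mxE [delta_mx _ _ _ _]mxE eqxx /=.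
  have [->|j0] := eqVneq j 0.
    rewrite mulr1 scale1r /=.
    have -> : vpow c 1 = c by apply/colP => i; rewrite [LHS]mxE expr1.
    have -> : vpow c 0 = ones R s.+1.
      by apply/colP => i; rewrite [LHS]mxE [RHS]mxE expr0.
    by [].
  have jj : (2 <= j.+1 <= s.+2)%N.
    by apply/andP; split; [rewrite ltnS lt0n | exact: leqW (ltn_ord j)].
  by rewrite mulr0 (cond2 _ jj) mxE.
have vQ : v^T *m Qmx Pm Rm c 1 *m x =
    - (v^T *m (Cmx c - 1%:M) *m V1 c *m invmx (Dmx R s.+1) *m invmx (V1 c) *m x).
  rewrite /Qmx Smx1 mulmx1 invr1 scale1r mulmxA mulmxBr mulmxBl mulmxBl firstrow.
  rewrite -lastV -scalemxAl -row_mul mulmxV ?unitmx_mul ?uV//.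
  rewrite -scalemxAl -row_mul mul1mx (_ : row _ x = 0) ?scaler0 ?sub0r.
    by rewrite invmx_mul// !mulmxA vPm.
  by apply/rowP => j; rewrite !mxE c_last// subrr expr0n.
rewrite /defect -scalemxAr !expr1n invr1 mulr1 scale1r.
rewrite [X in v^T *m X](_ : _ = (vpow c s.+2 - s.+2%:R *: (Rm *m vpow c s.+1))
   - Pm *m (Cmx c - 1%:M) *m x - s.+2%:R *: (Qmx Pm Rm c 1 *m x)); last first.
  by rewrite -mulmxA Cmx_sub1_vpow /= addrAC; congr (_ - _); exact: addrAC.
rewrite mulmxBr mulmxBr cond2 ?leqnn// sub0r !mulmxA vPm -scalemxAr mulmxA vQ.
(* [cond1] says that the contributions of P and Q to the defect cancel: the D^(-1) part of [Dtilde]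
   comes from Q, its identity part from P. *)
move: cond1; rewrite /Dtilde mulmxBr mulmx1 2!mulmxBl -!scalemxAr -!scalemxAl.
rewrite mulmxK// => /eqP; rewrite subr_eq0 => /eqP E.
by rewrite scalerN opprK E addNr scaler0.
Qed.

(** Fredholm alternative: a vector orthogonal to the kernel of I - P^T lies in the image of I - P.
    The columns of [cokermx] serve as test vectors v. *)
Lemma sub1_solvable (R : realType) (s : nat) (Pm : 'M[R]_s) (d : 'cV[R]_s) :
  (forall v : 'cV[R]_s, (1%:M - Pm^T) *m v = 0 -> v^T *m d = 0) ->
  exists g : 'cV[R]_s, Pm *m g = g - d.
Proof.
move=> dv; have : (d^T <= 1%:M - Pm^T)%MS.
  rewrite submxE; apply/eqP/matrixP => i j; rewrite ord1.
  have /dv : (1%:M - Pm^T) *m col j (cokermx (1%:M - Pm^T)) = 0.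
    by rewrite -col_mulmx mulmx_coker col0.
  move/(congr1 trmx); rewrite trmx_mul trmxK trmx0 -col_mulmx => /colP/(_ 0).
  by rewrite !mxE.
move=> /submxP[D /(congr1 trmx)]; rewrite trmxK => ->.
exists D^T; rewrite trmx_mul linearB /= trmx1 trmxK mulmxBl mul1mx.
by rewrite opprB addrC subrK.
Qed.

(** * Dependence on the step size ratio *)

(* The radius 1/2 keeps the step size ratio away from 0. *)
Definition lipschitz_at1 (R : realType) (V : normedZmodType R) (f : R -> V) :
    Prop :=
  exists2 L : R, 0 <= L &
    forall x, `|x - 1| <= 2^-1 -> `|f x - f 1| <= L * `|x - 1|.

Lemma lipschitz_at1_cst (R : realType) (V : normedZmodType R) (v : V) :
  lipschitz_at1 (fun _ : R => v).
Proof. by exists 0 => // x _; rewrite subrr normr0 mul0r. Qed.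

Lemma lipschitz_at1_id (R : realType) : lipschitz_at1 (fun x : R => x).
Proof. by exists 1 => // x _; rewrite mul1r. Qed.

Lemma lipschitz_at1N (R : realType) (V : normedZmodType R) (f : R -> V) :
  lipschitz_at1 f -> lipschitz_at1 (fun x => - f x).
Proof.
by move=> [L L0 fL]; exists L => // x /fL; rewrite -opprD normrN.
Qed.

Lemma lipschitz_at1D (R : realType) (V : normedZmodType R) (f g : R -> V) :
  lipschitz_at1 f -> lipschitz_at1 g -> lipschitz_at1 (fun x => f x + g x).
Proof.
move=> [L L0 fL] [M M0 gM]; exists (L + M) => [|x x1]; first exact: addr_ge0.
rewrite opprD addrACA mulrDl (le_trans (ler_normD _ _))//.
by rewrite lerD ?fL ?gM.
Qed.

Lemma lipschitz_at1_bounded (R : realType) (V : normedZmodType R)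
    (f : R -> V) : lipschitz_at1 f ->
  exists2 B : R, 0 <= B & forall x, `|x - 1| <= 2^-1 -> `|f x| <= B.
Proof.
move=> [L L0 fL]; exists (L + `|f 1|) => [|x x1]; first exact: addr_ge0.
rewrite -[f x](subrK (f 1)) (le_trans (ler_normD _ _))// lerD2r.
rewrite (le_trans (fL _ x1))// ler_piMr// (le_trans x1)//.
by rewrite invf_le1// ler1n.
Qed.

(** Product rule f g - f(1) g(1) = (f - f(1)) g + f(1) (g - g(1)), proved once for numbers, scaling
    and matrix products; C absorbs the dimension factor in the max norm of a matrix product. *)
Lemma lipschitz_at1_bilinear (R : realType) (U V W : normedZmodType R)
    (op : U -> V -> W) (C : R) (f : R -> U) (g : R -> V) :
  0 <= C -> (forall u v, `|op u v| <= C * (`|u| * `|v|)) ->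
  (forall u u' v, op (u - u') v = op u v - op u' v) ->
  (forall u v v', op u (v - v') = op u v - op u v') ->
  lipschitz_at1 f -> lipschitz_at1 g -> lipschitz_at1 (fun x => op (f x) (g x)).
Proof.
move=> C0 opC opBl opBr [L L0 fL] lg.
have [B B0 gB] := lipschitz_at1_bounded lg; have [M M0 gM] := lg.
exists (C * (L * B) + C * (`|f 1| * M)) => [|x x1].
  by rewrite addr_ge0// !mulr_ge0.
rewrite -(subrKA (op (f 1) (g x))) -opBl -opBr.
rewrite (le_trans (ler_normD _ _))// mulrDl lerD// (le_trans (opC _ _))//.
  by rewrite -mulrA ler_wpM2l// mulrAC ler_pM ?fL ?gB.
by rewrite -!mulrA ler_wpM2l// ler_wpM2l// gM.
Qed.

Lemma lipschitz_at1M (R : realType) (f g : R -> R) :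
  lipschitz_at1 f -> lipschitz_at1 g -> lipschitz_at1 (fun x => f x * g x).
Proof.
apply: (@lipschitz_at1_bilinear _ _ _ _ *%R 1) => // [u v|u u' v|u v v'].
- by rewrite mul1r normrM.
- exact: mulrBl.
- exact: mulrBr.
Qed.

Lemma lipschitz_at1Z (R : realType) (V : normedModType R) (f : R -> R)
    (g : R -> V) :
  lipschitz_at1 f -> lipschitz_at1 g -> lipschitz_at1 (fun x => f x *: g x).
Proof.
apply: (@lipschitz_at1_bilinear _ _ _ _ *:%R 1) => // [u v|u u' v|u v v'].
- by rewrite mul1r normrZ.
- exact: scalerBl.
- exact: scalerBr.
Qed.

Lemma lipschitz_at1_mulmx (R : realType) (m n p : nat) (f : R -> 'M[R]_(m, n))
    (g : R -> 'M[R]_(n, p)) :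
  lipschitz_at1 f -> lipschitz_at1 g -> lipschitz_at1 (fun x => f x *m g x).
Proof.
apply: (@lipschitz_at1_bilinear _ _ _ _ mulmx n%:R) => // [u v|u u' v|u v v'].
- exact: mulmx_norm_le.
- exact: mulmxBl.
- exact: mulmxBr.
Qed.

Lemma lipschitz_at1X (R : realType) (f : R -> R) (n : nat) :
  lipschitz_at1 f -> lipschitz_at1 (fun x => f x ^+ n).
Proof.
move=> lf; elim: n => [|n IH]; first exact: lipschitz_at1_cst.
rewrite (_ : (fun x => _) = (fun x => f x * f x ^+ n)).
  exact: lipschitz_at1M.
by apply/funext => x; rewrite exprS.
Qed.

Lemma invr_sub1_le (R : realType) (x : R) :
  `|x - 1| <= 2^-1 -> `|x^-1 - 1| <= 2 * `|x - 1|.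
Proof.
rewrite ler_norml => /andP[x1 _].
have x_ge : 2^-1 <= x by lra.
have x0 : 0 < x by rewrite (lt_le_trans _ x_ge)// invr_gt0.
have -> : x^-1 - 1 = - ((x - 1) * x^-1) by field; lra.
rewrite normrN normrM mulrC ler_wpM2r// ger0_norm ?invr_ge0 ?(ltW x0)//.
by rewrite invf_ple ?posrE.
Qed.

Lemma lipschitz_at1V (R : realType) : lipschitz_at1 (fun x : R => x^-1).
Proof. by exists 2 => // x /invr_sub1_le; rewrite invr1. Qed.

Lemma lipschitz_at1_mx (R : realType) (m n : nat) (f : R -> 'M[R]_(m, n)) :
  (forall i j, lipschitz_at1 (fun x => f x i j)) -> lipschitz_at1 f.
Proof.
move=> lf; have /choice[L fL] (ij : 'I_m * 'I_n) : exists L, 0 <= L /\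
    forall x, `|x - 1| <= 2^-1 -> `|f x ij.1 ij.2 - f 1 ij.1 ij.2| <= L * `|x - 1|.
  by have [L L0 ?] := lf ij.1 ij.2; exists L.
have L0 ij : 0 <= L ij by have [] := fL ij.
exists (\sum_ij L ij) => [|x x1]; first exact: sumr_ge0.
apply/mx_norm_leP => [|i j]; first by rewrite mulr_ge0// sumr_ge0.
rewrite mxE [X in _ + X]mxE; have [_ /(_ x x1)/le_trans] := fL (i, j); apply.
by rewrite ler_wpM2r// (bigD1 (i, j))//= lerDl sumr_ge0.
Qed.

Lemma lipschitz_at1_Qmx (R : realType) (s : nat) (Pm Rm : 'M[R]_s)
    (c : 'cV[R]_s) : lipschitz_at1 (Qmx Pm Rm c).
Proof.
apply: lipschitz_at1_mulmx; last exact: lipschitz_at1_cst.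
apply: lipschitz_at1D.
  apply: lipschitz_at1_mulmx; first exact: lipschitz_at1_cst.
  apply: lipschitz_at1_mx => i j.
  rewrite (_ : (fun x => _) = (fun x => x ^+ j * (i == j)%:R)).
    apply: lipschitz_at1M; last exact: lipschitz_at1_cst.
    exact/lipschitz_at1X/lipschitz_at1_id.
  by apply/funext => x; rewrite !mxE mulr_natr; case: eqP => [->|].
apply/lipschitz_at1N/lipschitz_at1Z; first exact: lipschitz_at1V.
exact: lipschitz_at1_cst.
Qed.

Lemma lipschitz_at1_defect (R : realType) (s : nat) (Pm Rm : 'M[R]_s)
    (c : 'cV[R]_s) (j : nat) :
  lipschitz_at1 (fun sigma => defect Pm Rm c sigma j).
Proof.
have lVX n : lipschitz_at1 (fun x : R => (x ^+ n)^-1).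
  rewrite (_ : (fun x => _) = (fun x => x^-1 ^+ n)).
    exact/lipschitz_at1X/lipschitz_at1V.
  by apply/funext => x; rewrite exprVn.
apply: lipschitz_at1Z; first exact: lipschitz_at1_cst.
apply: lipschitz_at1D; last exact: lipschitz_at1_cst.
apply: lipschitz_at1D.
  apply: lipschitz_at1D; first exact: lipschitz_at1_cst.
  by apply/lipschitz_at1N/lipschitz_at1Z => //; exact: lipschitz_at1_cst.
apply/lipschitz_at1N/lipschitz_at1Z.
  by apply: lipschitz_at1M => //; exact: lipschitz_at1_cst.
apply: lipschitz_at1_mulmx; last exact: lipschitz_at1_cst.
exact: lipschitz_at1_Qmx.
Qed.

(** * Residuals of the corrected exact values *)

(** Nodes and step are free so that a single expansion point serves two consecutive steps: t_(n-1) +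
    c_i dt_(n-1) = t_n + (c_i - 1) dt_(n-1), so the previous stages have nodes c - e around t_n. *)
Definition stages (R : realType) (s m : nat) (u : R -> 'rV[R]_m)
    (x : 'cV[R]_s) (t h : R) : 'M[R]_(s, m) :=
  \matrix_(i < s) u (t + x i 0 * h).

(* Taylor polynomial of [stages u x t h] in h, of degree k - 1. *)
Definition stages_poly (R : realType) (s m k : nat) (u : R -> 'rV[R]_m)
    (x : 'cV[R]_s) (t h : R) : 'M[R]_(s, m) :=
  \sum_(j < k) (h ^+ j / j`!%:R) *: (vpow x j *m u^`(j)%classic t).

Lemma stages_taylor (R : realType) (s m k : nat) (u : R -> 'rV[R]_m)
    (x : 'cV[R]_s) (a b M t h : R) :
  (forall j z, (j < k)%N -> z \in `[a, b]%R -> derivable u^`(j) z 1) ->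
  (forall z, z \in `[a, b]%R -> `|u^`(k) z| <= M) ->
  t \in `[a, b]%R -> (forall i, t + x i 0 * h \in `[a, b]%R) ->
  `|stages u x t h - stages_poly k u x t h| <= M * (`|x| * `|h|) ^+ k.
Proof.
move=> du uM tab xab.
have M0 : 0 <= M by rewrite (le_trans _ (uM t tab)).
apply/mx_norm_leP => [|i l]; first by rewrite mulr_ge0// exprn_ge0// mulr_ge0.
have -> : (stages u x t h - stages_poly k u x t h) i l =
    (u (t + x i 0 * h) -
     \sum_(j < k) ((t + x i 0 * h - t) ^+ j / j`!%:R) *: u^`(j)%classic t) 0 l.
  rewrite [LHS]mxE [RHS]mxE mxE [in LHS]mxE [in RHS]mxE !summxE; congr (_ - _).
  apply: eq_bigr => j _; rewrite mxE [in LHS]mxE big_ord1 [in RHS]mxE !mxE.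
  by rewrite [t + _]addrC addrK exprMn; ring.
rewrite (le_trans (mx_entry_le _ _ _))//.
rewrite (le_trans (taylor_ineq du uM tab (xab i)))// ler_wpM2l//.
rewrite [t + _]addrC addrK normrM lerXn2r ?nnegrE ?mulr_ge0//.
by rewrite ler_wpM2r// mx_entry_le.
Qed.

(** The coefficient of h^j u^(j)(t) is d_j by the very definition of the defect, h / sigma being the
    previous step size. Pre-consistency removes j = 0 and the stage order removes j = 1, ..., s. The
    polynomials of u' have one term fewer because the factor h raises their powers. *)
Lemma stages_poly_defect (R : realType) (s m : nat) (u : R -> 'rV[R]_m)
    (Pm Rm : 'M[R]_s) (c : 'cV[R]_s) (sigma t h : R) :
  sigma != 0 -> Pm *m ones R s = ones R s ->
  (forall j, (1 <= j <= s)%N -> defect Pm Rm c sigma j = 0) ->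
  stages_poly s.+2 u c t h
  - Pm *m stages_poly s.+2 u (c - ones R s) t (h / sigma)
  - h *: (Qmx Pm Rm c sigma
          *m stages_poly s.+1 u^`() (c - ones R s) t (h / sigma))
  - h *: (Rm *m stages_poly s.+1 u^`() c t h)
  = h ^+ s.+1 *: (defect Pm Rm c sigma s.+1 *m u^`(s.+1)%classic t).
Proof.
move=> sigma0 Pe d0; set Q := Qmx _ _ _ _.
have v0 (x : 'cV[R]_s) : vpow x 0 = ones R s.
  by apply/colP => i; rewrite !mxE expr0.
rewrite /stages_poly [in X in X - _]big_ord_recl [in X in _ - _ *m X]big_ord_recl.
rewrite !expr0 fact0 !v0 mulmxDr -scalemxAr mulmxA Pe.
rewrite opprD !addrA [X in X - _ - _ - _]addrAC subrr add0r.
rewrite !mulmx_sumr !scaler_sumr -!sumrB.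
transitivity (\sum_(j < s.+1)
    h ^+ j.+1 *: (defect Pm Rm c sigma j.+1 *m u^`(j.+1)%classic t)).
  apply: eq_bigr => j _; rewrite lift0 -!derive1Sn /defect -/Q; clearbody Q.
  rewrite -!scalemxAr !mulmxA !scalerA !scalemxAl -!mulmxBl; congr (_ *m _).
  rewrite -!scalemxAl scalerA !scalerBr !scalerA /= factS natrM.
  have jf : j`!%:R != 0 :> R by rewrite pnatr_eq0 -lt0n fact_gt0.
  have jS : j.+1%:R != 0 :> R by rewrite pnatr_eq0.
  move: (j`!%:R) (j.+1%:R : R) jf jS => f n f0 n0.
  congr (_ - _ - _ - _).
  - by congr (_ *: _); rewrite expr_div_n mulrAC.
  - congr (_ *: _); rewrite expr_div_n exprS; field.
    by rewrite f0 n0 expf_neq0.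
  - by congr (_ *: _); rewrite exprS; field; rewrite f0 n0.
rewrite big_ord_recr /= big1 ?add0r// => j _.
by rewrite d0 ?mul0mx ?scaler0//=; exact: ltn_ord.
Qed.

Lemma Fstages_lipschitz (R : realType) (s m : nat) (F : 'rV[R]_m -> 'rV[R]_m)
    (B L : R) (X Y : 'M[R]_(s, m)) : 0 <= L ->
  (forall x y, `|x| <= B -> `|y| <= B -> `|F x - F y| <= L * `|x - y|) ->
  `|X| <= B -> `|Y| <= B -> `|Fstages F X - Fstages F Y| <= L * `|X - Y|.
Proof.
move=> L0 FL XB YB.
have row_le (Z : 'M[R]_(s, m)) i : `|row i Z| <= `|Z|.
  by apply/mx_norm_leP => // k l; rewrite mxE mx_entry_le.
apply/mx_norm_leP => [|i l]; first exact: mulr_ge0.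
rewrite mxE [X in _ + X]mxE !mxE.
have -> : F (row i X) 0 l - F (row i Y) 0 l = (F (row i X) - F (row i Y)) 0 l.
  by rewrite [RHS]mxE [in RHS]mxE.
rewrite (le_trans (mx_entry_le _ _ _))//.
rewrite (le_trans (FL _ _ _ _)) ?(le_trans (row_le _ _))//.
by rewrite ler_wpM2l// -linearB row_le.
Qed.

(** Here tau is dt_(i-1) / dt_i, the inverse of the ratio sigma_i. The radius 1/4 puts both tau and
    1/tau within 1/2 of 1, where the Lipschitz bounds in the ratio hold. *)
Lemma step_ratio_bounds (R : realType) (tau : R) : `|tau - 1| <= 4^-1 ->
  [/\ 0 < tau, tau <= 2, `|tau - 1| <= 2^-1, `|tau^-1 - 1| <= 2 * `|tau - 1|
    & `|tau^-1 - 1| <= 2^-1].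
Proof.
move=> tau1; have tau2 : `|tau - 1| <= 2^-1 by lra.
have tauV := invr_sub1_le tau2.
have taub : - 4^-1 <= tau - 1 <= 4^-1 by rewrite -ler_norml.
by split => //; lra.
Qed.

(** The threshold gives 2 h <= 1 and 2 h G <= 1: one factor 2 h absorbs G and the others are at most
    1. The powers of 2 allow for a previous step of size up to 2 h. *)
Lemma correction_le1 (R : realType) (G h : R) (n : nat) :
  0 <= G -> 0 < h <= (2 * (1 + G))^-1 ->
  2 ^+ n.+1 * G * h ^+ n.+1 <= 1.
Proof.
move=> G0 /andP[h0 hG].
have G1 : 0 < 1 + G by rewrite ltr_pwDl.
have h2 : 2 * h <= (1 + G)^-1 by rewrite -ler_pdivlMl// -invfM.
have h21 : 2 * h <= 1 by rewrite (le_trans h2)// invf_le1// lerDl.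
have h20 : 0 <= 2 * h by rewrite mulr_ge0// ltW.
rewrite mulrAC -exprMn exprSr -mulrA.
apply: le_trans (_ : 1 * ((1 + G)^-1 * (1 + G)) <= _); last first.
  by rewrite mul1r mulVf ?gt_eqF.
apply: ler_pM; rewrite ?exprn_ge0 ?exprn_ile1 ?(ltW h0) ?mulr_ge0 ?(ltW h0)//.
by apply: ler_pM => //; rewrite lerDr.
Qed.

Lemma mulmx_norm_le2 (R : realType) (m n p : nat) (A : 'M[R]_(m, n))
    (B : 'M[R]_(n, p)) (x y : R) :
  `|A| <= x -> `|B| <= y -> `|A *m B| <= n%:R * (x * y).
Proof.
by move=> Ax By; rewrite (le_trans (mulmx_norm_le _ _))// ler_wpM2l// ler_pM.
Qed.

(* A and B stand for Taylor polynomials of the exact stages W and of their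
   derivatives V = F(W); only Taylor remainders, Lipschitz increments of F and
   differences against frozen coefficients are left on the right. *)
Lemma corrected_residual_split (R : realType) (s m : nat) (Pm Qm Rm : 'M[R]_s)
    (g d d1 : 'cV[R]_s) (U U0 : 'rV[R]_m) (h x y : R)
    (W0 W1 A0 A1 V0 V1 B0 B1 F0 F1 : 'M[R]_(s, m)) :
  Pm *m g = g - d1 ->
  A1 - Pm *m A0 - h *: (Qm *m B0) - h *: (Rm *m B1) = x *: (d *m U) ->
  (W1 - x *: (g *m U))
    - (Pm *m (W0 - y *: (g *m U0)) + h *: (Qm *m F0) + h *: (Rm *m F1))
  = (W1 - A1) + - (Pm *m (W0 - A0)) + - (h *: (Qm *m (V0 - B0)))
    + - (h *: (Rm *m (V1 - B1))) + h *: (Qm *m (V0 - F0))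
    + h *: (Rm *m (V1 - F1)) + x *: ((d - d1) *m U)
    + (y - x) *: ((Pm *m g) *m U0) + - (x *: ((Pm *m g) *m (U - U0))).
Proof.
move=> Pg main; rewrite !mulmxBr -!scalemxAr !mulmxA Pg !mulmxBl.
rewrite !(scalerBr x) -main.
move: (Pm *m A0) (Qm *m B0) (Rm *m B1) (Pm *m W0) (Qm *m V0) (Rm *m V1).
move: (Qm *m F0) (Rm *m F1) (g *m U) (g *m U0) (d1 *m U) (d1 *m U0).
by move=> *; apply/matrixP => i j; rewrite !mxE; ring.
Qed.

(* Primes mark a compact subinterval on which all derivatives are bounded;
   index 0 refers to the previous step, whose size is eta = tau h. *)
Lemma corrected_residual_le (R : realType) (s m : nat)
    (F : 'rV[R]_m -> 'rV[R]_m) (u : R -> 'rV[R]_m) (a b a' b' : R)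
    (Pm Rm : 'M[R]_s) (c g : 'cV[R]_s) :
  cont_diff F -> a < a' -> b' < b -> Ck_on a b s.+2 u -> solves F a b u ->
  Pm *m ones R s = ones R s -> Pm *m g = g - defect Pm Rm c 1 s.+1 ->
  exists C h0 : R, [/\ 0 <= C, 0 < h0 &
  forall (t t0 h eta tau : R) (W0 W1 : 'M[R]_(s, m)),
    0 < h <= h0 -> `|tau - 1| <= 4^-1 -> eta = tau * h -> t0 = t - eta ->
    t \in `[a', b']%R -> t0 \in `[a', b']%R ->
    (forall i, t + c i 0 * h \in `[a', b']%R) ->
    (forall i, t + (c - ones R s) i 0 * eta \in `[a', b']%R) ->
    (forall j, (1 <= j <= s)%N -> defect Pm Rm c tau^-1 j = 0) ->
    W0 = stages u (c - ones R s) t eta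
         - eta ^+ s.+1 *: (g *m u^`(s.+1)%classic t0) ->
    W1 = stages u c t h - h ^+ s.+1 *: (g *m u^`(s.+1)%classic t) ->
    `|W1 - (Pm *m W0 + h *: (Qmx Pm Rm c tau^-1 *m Fstages F W0)
            + h *: (Rm *m Fstages F W1))|
      <= C * (h ^+ s.+1 * (h + `|tau - 1|))].
Proof.
move=> dF aa' bb' uC uF Pe Pg.
have [M M0 uM] := Ck_on_derive1n_bounded aa' bb' uC.
(* Exact stages are bounded by M and, for small h, corrections by 1, so all arguments of F stay in
   the ball of radius M + 1. *)
have [LF LF0 FL] := cont_diff_lipschitz (M + 1) dF.
have [BQ BQ0 QB] := lipschitz_at1_bounded (lipschitz_at1_Qmx Pm Rm c).
have [Ld Ld0 dL] := lipschitz_at1_defect Pm Rm c s.+1.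
have [Lp Lp0 pL] := lipschitz_at1X s.+1 (lipschitz_at1_id R).
have ab_in z : z \in `[a', b']%R -> a < z < b.
  by rewrite in_itv /= => /andP[/(lt_le_trans aa') -> /le_lt_trans ->].
have du j z : (j < s.+2)%N -> z \in `[a', b']%R -> derivable u^`(j) z 1.
  by move=> js /ab_in; case: uC => duj _; apply: duj.
have du' j z : (j < s.+1)%N -> z \in `[a', b']%R -> derivable u^`()^`(j) z 1.
  by rewrite -derive1Sn => js; apply: du.
have uM' z : z \in `[a', b']%R -> `|u^`()^`(s.+1) z| <= M.
  by rewrite -derive1Sn; apply: uM.
have uMs z : z \in `[a', b']%R -> `|u^`(s.+2) z| <= M by apply: uM.
pose Gm := `|g| * M.
have Gm0 : 0 <= Gm by rewrite mulr_ge0.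
pose K2 := 2 * `|c - ones R s|.
have K20 : 0 <= K2 by rewrite mulr_ge0.
(* C1 to C9 bound, in this order, the nine summands of [corrected_residual_split] in units of
   h^(s+1) (h + |tau - 1|). The factors 2 come from allowing steps up to 2 h, except in C7, where
   |1/tau - 1| <= 2 |tau - 1| is used. *)
pose C1 := M * `|c| ^+ s.+2.
pose C2 := s%:R * (`|Pm| * (M * K2 ^+ s.+2)).
pose C3 := s%:R * (BQ * (M * K2 ^+ s.+1)).
pose C4 := s%:R * (`|Rm| * (M * `|c| ^+ s.+1)).
pose C5 := s%:R * (BQ * (LF * (2 ^+ s.+1 * Gm))).
pose C6 := s%:R * (`|Rm| * (LF * (2 ^+ s.+1 * Gm))).
pose C7 := Ld * 2 * M.
pose C8 := Lp * (`|Pm *m g| * M).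
pose C9 := `|Pm *m g| * (M * 2).
have K2X n : 0 <= K2 ^+ n by exact: exprn_ge0.
have cX n : 0 <= `|c| ^+ n by exact: exprn_ge0.
have X2 n : 0 <= 2 ^+ n :> R by exact: exprn_ge0.
have C10 : 0 <= C1 by rewrite mulr_ge0.
have C20 : 0 <= C2 by rewrite mulr_ge0// mulr_ge0// mulr_ge0.
have C30 : 0 <= C3 by rewrite mulr_ge0// mulr_ge0// mulr_ge0.
have C40 : 0 <= C4 by rewrite mulr_ge0// mulr_ge0// mulr_ge0.
have C50 : 0 <= C5 by rewrite mulr_ge0// mulr_ge0// mulr_ge0// mulr_ge0.
have C60 : 0 <= C6 by rewrite mulr_ge0// mulr_ge0// mulr_ge0// mulr_ge0.
have C70 : 0 <= C7 by rewrite mulr_ge0// mulr_ge0.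
have C80 : 0 <= C8 by rewrite mulr_ge0// mulr_ge0.
have C90 : 0 <= C9 by rewrite mulr_ge0// mulr_ge0.
exists (C1 + C2 + C3 + C4 + C5 + C6 + C7 + C8 + C9), (2 * (1 + Gm))^-1.
split=> [||t t0 h eta tau W0 W1 hb tau1 etaE t0E tab t0ab cab cab' d0 W0E W1E].
- by rewrite !addr_ge0.
- by rewrite invr_gt0 mulr_gt0// ltr_pwDl.
have [tau_gt0 tau_le tau2 sigma1 sigma2] := step_ratio_bounds tau1.
have h0 : 0 <= h by case/andP: hb => /ltW.
have eta0 : 0 <= eta by rewrite etaE mulr_ge0// ltW.
have eta_le : eta <= 2 * h by rewrite etaE ler_wpM2r.
have hX n : 0 <= h ^+ n by exact: exprn_ge0.
have gU z : z \in `[a', b']%R -> `|g *m u^`(s.+1)%classic z| <= Gm.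
  move=> zab; rewrite (le_trans (mulmx_norm_le _ _))// mul1r.
  by rewrite ler_wpM2l// uM.
have stM (x : 'cV[R]_s) k : (forall i, t + x i 0 * k \in `[a', b']%R) ->
    `|stages u x t k| <= M.
  move=> xab; apply/mx_norm_leP => // i l; rewrite mxE.
  by rewrite (le_trans (mx_entry_le _ _ _))// (uM 0%N).
have stF (x : 'cV[R]_s) k : (forall i, t + x i 0 * k \in `[a', b']%R) ->
    Fstages F (stages u x t k) = stages u^`() x t k.
  move=> xab; apply/row_matrixP => i; rewrite !rowK.
  have [_ du1] := uF _ (ab_in _ (xab i)).
  by rewrite derive1E du1.
(* Stated for both time levels: k is h or eta, each at most 2 h. *)
have corr (x : 'cV[R]_s) k z Z : (forall i, t + x i 0 * k \in `[a', b']%R) ->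
    0 <= k <= 2 * h -> z \in `[a', b']%R ->
    Z = stages u x t k - k ^+ s.+1 *: (g *m u^`(s.+1)%classic z) ->
    `|stages u^`() x t k - Fstages F Z| <= LF * (2 ^+ s.+1 * Gm * h ^+ s.+1).
  move=> xab /andP[k0 kh] zab ZE; rewrite -(stF _ _ xab).
  have XZ : `|k ^+ s.+1 *: (g *m u^`(s.+1)%classic z)|
      <= 2 ^+ s.+1 * Gm * h ^+ s.+1.
    rewrite normrZ ger0_norm ?exprn_ge0// mulrAC ler_pM ?exprn_ge0 ?gU//.
    by rewrite -exprMn lerXn2r ?nnegrE// mulr_ge0.
  have stx := stM _ _ xab.
  apply: le_trans (Fstages_lipschitz LF0 FL _ _) _.
  - by rewrite (le_trans stx)// lerDl.
  - rewrite ZE (le_trans (ler_normB _ _))// lerD// (le_trans XZ)//.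
    exact: correction_le1.
  - by rewrite ZE subKr ler_wpM2l.
have F0 := corr _ _ _ _ cab' _ t0ab W0E.
have F1 := corr _ _ _ _ cab _ tab W1E.
have hh : 0 <= h <= 2 * h by rewrite h0 ler_peMl// ler1n.
have {}F0 := F0 (introT andP (conj eta0 eta_le)).
have {}F1 := F1 hh.
have T1 := stages_taylor du uMs tab cab.
have T0 := stages_taylor du uMs tab cab'.
have S1 := stages_taylor du' uM' tab cab.
have S0 := stages_taylor du' uM' tab cab'.
rewrite (ger0_norm h0) exprMn mulrA in T1.
rewrite (ger0_norm h0) exprMn mulrA in S1.
have rem n : M * (`|c - ones R s| * `|eta|) ^+ n <= M * K2 ^+ n * h ^+ n.
  rewrite -mulrA (ler_wpM2l M0)// -exprMn lerXn2r ?nnegrE ?mulr_ge0//.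
  by rewrite ger0_norm// /K2 -mulrA mulrCA ler_wpM2l.
have {}T0 := le_trans T0 (rem _).
have {}S0 := le_trans S0 (rem _).
have sigma0 : tau^-1 != 0 by rewrite invr_neq0// gt_eqF.
have main := stages_poly_defect u t h sigma0 Pe d0.
have etaV : h / tau^-1 = eta by rewrite invrK mulrC.
rewrite etaV in main.
have dU : `|u^`(s.+1)%classic t - u^`(s.+1)%classic t0| <= M * (2 * h).
  apply: le_trans (mean_value_ineq (B := M) _ t0ab tab _) _.
  - by move=> z; apply: du.
  - by move=> z zab _; apply: uMs.
  - by rewrite t0E opprB addrC subrK ger0_norm// ler_wpM2l.
set e := h ^+ s.+1 * (h + `|tau - 1|).
have e_h : h ^+ s.+2 <= e by rewrite exprSr ler_wpM2l// lerDl.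
have e_tau : h ^+ s.+1 * `|tau - 1| <= e by rewrite ler_wpM2l// lerDr.
have QB' := QB _ sigma2.
have dB : `|defect Pm Rm c tau^-1 s.+1 - defect Pm Rm c 1 s.+1|
    <= Ld * (2 * `|tau - 1|).
  by rewrite (le_trans (dL _ sigma2))// ler_wpM2l.
have pB : `|eta ^+ s.+1 - h ^+ s.+1| <= h ^+ s.+1 * (Lp * `|tau - 1|).
  have -> : eta ^+ s.+1 - h ^+ s.+1 = h ^+ s.+1 * (tau ^+ s.+1 - 1 ^+ s.+1).
    by rewrite etaE exprMn expr1n mulrBr mulr1 mulrC.
  by rewrite normrM (ger0_norm (hX _)) ler_wpM2l// pL.
have UM := uM s.+1 t (leqnSn _) tab.
have U0M := uM s.+1 t0 (leqnSn _) t0ab.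
rewrite {1}W1E {1}W0E.
rewrite (@corrected_residual_split _ _ _ _ _ _ _ _ _ _ _ _ _ _ _ _ _ _
  (stages u^`() (c - ones R s) t eta) (stages u^`() c t h) _ _ _ _ Pg main).
(* Terms with the step size in front only need a bound O(h^(s+1)). *)
have hZ (X : 'M[R]_(s, m)) C k : 0 <= C -> `|X| <= C * h ^+ s.+1 ->
    `|h *: X| <= C * e.
  move=> C0 XC; rewrite normrZ ger0_norm//.
  apply: le_trans (_ : h * (C * h ^+ s.+1) <= _); first exact: ler_wpM2l.
  by rewrite mulrCA -exprS ler_wpM2l.
have addle (X Y : 'M[R]_(s, m)) C C' : `|X| <= C * e -> `|Y| <= C' * e ->
    `|X + Y| <= (C + C') * e.
  by move=> XC YC; rewrite (le_trans (ler_normD _ _))// mulrDl lerD.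
apply: (addle _ _ _ _ (addle _ _ _ _ (addle _ _ _ _ (addle _ _ _ _
  (addle _ _ _ _ (addle _ _ _ _ (addle _ _ _ _ (addle _ _ _ _ _ _) _) _) _)
  _) _) _) _); rewrite ?normrN.
- by rewrite (le_trans T1)// ler_wpM2l.
- apply: le_trans (mulmx_norm_le2 (lexx _) T0) _.
  rewrite [leLHS](_ : _ = C2 * h ^+ s.+2); last by rewrite /C2; ring.
  exact: ler_wpM2l.
- apply: hZ => //; apply: le_trans (mulmx_norm_le2 QB' S0) _.
  by rewrite /C3 !mulrA.
- apply: hZ => //; apply: le_trans (mulmx_norm_le2 (lexx _) S1) _.
  by rewrite /C4 !mulrA.
- apply: hZ => //; apply: le_trans (mulmx_norm_le2 QB' F0) _.
  by rewrite /C5 !mulrA.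
- apply: hZ => //; apply: le_trans (mulmx_norm_le2 (lexx _) F1) _.
  by rewrite /C6 !mulrA.
- rewrite normrZ (ger0_norm (hX _)).
  have := mulmx_norm_le2 dB UM; rewrite mul1r => dUB.
  apply: le_trans (_ : h ^+ s.+1 * (Ld * (2 * `|tau - 1|) * M) <= _).
    exact: ler_wpM2l.
  rewrite [leLHS](_ : _ = C7 * (h ^+ s.+1 * `|tau - 1|)); last by rewrite /C7; ring.
  exact: ler_wpM2l.
- rewrite normrZ.
  have := mulmx_norm_le2 (lexx `|Pm *m g|) U0M; rewrite mul1r => PgB.
  apply: le_trans (_ : h ^+ s.+1 * (Lp * `|tau - 1|) * (`|Pm *m g| * M) <= _).
    exact: ler_pM.
  rewrite [leLHS](_ : _ = C8 * (h ^+ s.+1 * `|tau - 1|)); last by rewrite /C8; ring.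
  exact: ler_wpM2l.
- rewrite normrZ (ger0_norm (hX _)).
  have := mulmx_norm_le2 (lexx `|Pm *m g|) dU; rewrite mul1r => PgB.
  apply: le_trans (_ : h ^+ s.+1 * (`|Pm *m g| * (M * (2 * h))) <= _).
    exact: ler_wpM2l.
  rewrite [leLHS](_ : _ = C9 * h ^+ s.+2); last first.
    by rewrite /C9 [h ^+ s.+2]exprSr; ring.
  exact: ler_wpM2l.
Qed.

(** * Grids and convergence *)

Lemma gtimeS (R : realType) (dt : nat -> R) (n : nat) :
  gtime dt n.+1 = gtime dt n + dt n.
Proof. by rewrite /gtime big_ord_recr. Qed.

Lemma gtime_ge0 (R : realType) (dt : nat -> R) (n : nat) :
  (forall i, 0 < dt i) -> 0 <= gtime dt n.
Proof. by move=> dt0; apply: sumr_ge0 => i _; apply: ltW. Qed.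

Lemma gtime_le (R : realType) (dt : nat -> R) (i n : nat) :
  (forall i, 0 < dt i) -> (i <= n)%N -> gtime dt i <= gtime dt n.
Proof.
move=> dt0; elim: n => [|n IH]; first by rewrite leqn0 => /eqP ->.
rewrite leq_eqVlt => /orP[/eqP ->//|/IH/le_trans]; apply.
by rewrite gtimeS lerDl ltW.
Qed.

Lemma dt_le_dtmax (R : realType) (dt : nat -> R) (i n : nat) :
  (i <= n)%N -> dt i <= dtmax dt n.
Proof.
move=> i_n; rewrite /dtmax.
exact: (le_bigmax _ (fun i : 'I_n.+1 => dt i) (Ordinal (i_n : (i < n.+1)%N))).
Qed.

(** The residuals involve dt_1, ..., dt_n, whereas t_n adds up dt_0, ..., dt_(n-1); the extra last
    step is later bounded by 1. *)
Lemma sum_dt_le (R : realType) (dt : nat -> R) (n : nat) :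
  (forall i, 0 < dt i) -> \sum_(1 <= i < n.+1) dt i <= gtime dt n + dt n.
Proof.
move=> dt0; rewrite -gtimeS /gtime -(big_mkord xpredT).
by rewrite [leRHS]big_ltn// lerDr ltW.
Qed.

(** Halving the gaps between [0, T] and the ends of ]a, b[ leaves a compact interval with room for
    stage points whose c_i lies outside [0, 1]. *)
Lemma mem_inner_itv (R : realFieldType) (a b T t y : R) :
  0 <= t <= T -> `|y| <= Num.min (- a / 2) ((b - T) / 2) ->
  t + y \in `[a / 2, (T + b) / 2]%R.
Proof.
move=> /andP[t0 tT]; rewrite le_min !ler_norml in_itv /=.
by move=> /andP[/andP[? ?] /andP[? ?]]; apply/andP; split; lra.
Qed.

Theorem theorem2p2 (R : realType) (m s : nat)
  (* problem on the time interval [0, T]; u is given on a neighbourhood ]a, b[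
     so that all the stage values are defined for small steps *)
  (F : 'rV[R]_m -> 'rV[R]_m) (u0 : 'rV[R]_m) (u : R -> 'rV[R]_m) (T a b : R)
  (T_gt0 : 0 < T) (a_lt0 : a < 0) (T_ltb : T < b)
  (F_smooth : cont_diff F)
  (u_smooth : Ck_on a b s.+2 u)
  (u_sol : solves F a b u) (u_init : u 0 = u0)
  (* norms on R^(m s) and R^m *)
  (N : 'M[R]_(s, m) -> R) (N_norm : is_norm N)
  (NR : 'rV[R]_m -> R) (NR_norm : is_norm NR)
  (* coefficients *)
  (Pm Rm : 'M[R]_s) (c : 'cV[R]_s) (gamma smin smax : R)
  (s_gt0 : (0 < s)%N)
  (c_inj : injective (fun i : 'I_s => c i 0))
  (c_last : forall i : 'I_s, i.+1 = s -> c i 0 = 1)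
  (Rm_trig : is_trig_mx Rm)
  (gamma_gt0 : 0 < gamma) (Rm_diag : forall i, Rm i i = gamma)
  (smin_ge0 : 0 <= smin)
  (order_s : stage_order smin smax Pm Rm c s)
  (* family of grids and of numerical solutions *)
  (I : Type) (dt : I -> nat -> R) (w : I -> nat -> 'M[R]_(s, m))
  (dt_gt0 : forall k n, 0 < dt k n)
  (dt_ratio : forall k n, (0 < n)%N -> gtime (dt k) n <= T ->
     smin < gratio (dt k) n < smax)
  (w_peer : forall k n, (0 < n)%N -> gtime (dt k) n <= T ->
     w k n = peer_rhs F Pm Rm c (dt k) (w k) n)
  (K : R)
  (w_stable : peer_stable N F u Pm Rm c dt w T K)
  (w_estimate : error_estimate N NR u Pm Rm c dt w T K)
  (w_start : exists L : R, small_steps dt T (fun k _ =>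
     N (global_error u c (dt k) (w k) 0%N) <= L * dt k 0%N ^+ s.+1))
  (dt_slow : exists L : R, small_steps dt T (fun k n =>
     forall i, (1 <= i <= n)%N ->
       exists2 theta : R, `|theta| <= L * dtmax (dt k) n
                        & dt k i.-1 = (1 + theta) * dt k i))
  (order_cond : forall v : 'cV[R]_s, (1%:M - Pm^T) *m v = 0 ->
     v^T *m (Cmx c - 1%:M) *m V1 c *m Dtilde R s *m invmx (V1 c)
       *m vpow (c - ones R s) s = 0
     /\ forall j : nat, (2 <= j <= s.+1)%N ->
          v^T *m (vpow c j - j%:R *: (Rm *m vpow c j.-1)) = 0) :
  convergent_of_order N u c dt w T s.+1.
Proof.
have [Pe d_s] := order_s.
have uO : forall v : 'cV[R]_s, (1%:M - Pm^T) *m v = 0 ->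
    v^T *m defect Pm Rm c 1 s.+1 = 0.
  by move=> v vP; have [c1 c2] := order_cond v vP; apply: defect1_ortho.
have [g Pg] := sub1_solvable uO.
have [NT NZ _] := N_norm.
have [CN CN0 NC] := norm_le_mx_norm N_norm.
pose a' := a / 2; pose b' := (T + b) / 2.
have aa' : a < a' by rewrite /a'; lra.
have bb' : b' < b by rewrite /b'; lra.
have [M M0 uM] := Ck_on_derive1n_bounded aa' bb' u_smooth.
have [C [hr [C0 hr0 resC]]] :=
  corrected_residual_le F_smooth aa' bb' u_smooth u_sol Pe Pg.
have [rho0 rho0_gt0 [hs hs0 stab]] := w_stable.
have [L0 [h1 h10 start]] := w_start.
have [L1 [h2 h20 slow]] := dt_slow.
pose Gm := `|g| * M.
have Gm0 : 0 <= Gm by rewrite mulr_ge0.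
pose cM := 1 + `|c| + `|c - ones R s|.
have cM0 : 0 < cM by rewrite /cM -addrA ltr_pwDl// addr_ge0.
pose hd := Num.min (- a / 2) ((b - T) / 2) / cM.
have hd0 : 0 < hd by rewrite divr_gt0// lt_min !divr_gt0 ?oppr_gt0 ?subr_gt0.
pose ht := (4 * (1 + `|L1|))^-1.
have ht0 : 0 < ht by rewrite invr_gt0 mulr_gt0// ltr_pwDl.
pose hq := rho0 / (1 + CN * Gm).
have CG : 0 <= CN * Gm by rewrite mulr_ge0// ltW.
have hq0 : 0 < hq by rewrite divr_gt0// ltr_pwDl.
(* With H the largest step, the bound 1 gives H^(s+1) <= H and dt_n <= 1; [hd] keeps the stage
   points of both levels in [a', b'], [ht] gives |theta| <= 1/4, and [hq] makes the corrections at
   most rho0. *)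
pose H0 := Num.min 1 (Num.min hs (Num.min h1 (Num.min h2 (Num.min hr
  (Num.min hd (Num.min ht hq)))))).
(* B1 measures the correction, which enters at the starting values and again when it is undone at
   the end; B2 collects the residuals over a length of at most T + 1. Absolute values appear because
   K, L0 and L1 come without a sign. *)
pose B1 := CN * Gm.
pose B2 := CN * (C * (1 + `|L1|)) * (T + 1).
exists (`|K| * (B1 + `|L0| + B2) + B1), H0 => [|k n nT].
  by rewrite /H0 !lt_min ltr01 hs0 h10 h20 hr0 hd0 ht0 hq0.
set H := dtmax (dt k) n.
rewrite /H0 !le_min => /andP[H1 /andP[Hs /andP[Hh1 /andP[Hh2 /andP[Hr
  /andP[Hd /andP[Ht Hq]]]]]]].
have dtk := dt_gt0 k.
have dtH i : (i <= n)%N -> 0 < dt k i <= H.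
  by move=> i_n; rewrite dtk dt_le_dtmax.
have Hge0 : 0 < H by have /andP[/lt_le_trans] := dtH 0%N isT; apply.
have HX : 0 <= H ^+ s.+1 by rewrite exprn_ge0// ltW.
have gT i : (i <= n)%N -> 0 <= gtime (dt k) i <= T.
  by move=> i_n; rewrite gtime_ge0// (le_trans (gtime_le dtk i_n)).
have dom t y : 0 <= t <= T -> `|y| <= cM * H -> t + y \in `[a', b']%R.
  move=> /andP[t0 tT] yH; have : cM * H <= Num.min (- a / 2) ((b - T) / 2).
    by rewrite mulrC -ler_pdivlMr.
  by move=> /(le_trans yH); apply: mem_inner_itv; rewrite t0.
have domg i : (i <= n)%N -> gtime (dt k) i \in `[a', b']%R.
  by move=> /gT it; rewrite -[gtime _ _]addr0 dom// normr0 mulr_ge0// ltW.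
have domx (x : 'cV[R]_s) t h : 0 <= t <= T -> `|x| <= cM -> 0 < h <= H ->
    forall l, t + x l 0 * h \in `[a', b']%R.
  move=> tT xc /andP[h0 hH] l; apply: dom => //.
  rewrite normrM ler_pM// ?(le_trans (mx_entry_le _ _ _))//.
  by rewrite gtr0_norm.
have c_cM : `|c| <= cM by rewrite /cM -addrA addrCA lerDl addr_ge0.
have c1_cM : `|c - ones R s| <= cM by rewrite /cM lerDr addr_ge0.
pose Z i := dt k i ^+ s.+1 *: (g *m u^`(s.+1)%classic (gtime (dt k) i)).
pose wt i := exact_stages u c (dt k) i - Z i.
have ZB i : (i <= n)%N -> N (Z i) <= B1 * H ^+ s.+1.
  move=> i_n; rewrite (le_trans (NC _))// /B1 -mulrA ler_wpM2l ?(ltW CN0)//.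
  have /andP[d0 dH] := dtH i i_n.
  have dX : 0 <= dt k i ^+ s.+1 by rewrite exprn_ge0// ltW.
  rewrite normrZ (ger0_norm dX) mulrC ler_pM//.
    rewrite (le_trans (mulmx_norm_le _ _))// mul1r ler_wpM2l//.
    by apply: uM => //; exact: domg.
  by rewrite lerXn2r// ?nnegrE ltW.
have Zrho i : (i <= n)%N -> N (Z i) <= rho0.
  move=> /ZB /le_trans; apply.
  have HH : H ^+ s.+1 <= H by rewrite exprS ger_pMr// exprn_ile1// ltW.
  apply: le_trans (_ : (1 + CN * Gm) * H <= _).
    by rewrite ler_pM// lerDr.
  by rewrite mulrC -ler_pdivlMr// ltr_pwDl.
have NN A : N (- A) = N A by rewrite -scaleN1r NZ normrN1 mul1r.
have res i : (1 <= i <= n)%N ->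
    N (peer_residual F Pm Rm c (dt k) wt i)
      <= CN * (C * (1 + `|L1|)) * (dt k i * H ^+ s.+1).
  move=> i1n; have /andP[i1 i_n] := i1n.
  case: i => // i in i1n i1 i_n *.
  have i_n' : (i <= n)%N by exact: ltnW.
  have [theta thL thE] := slow k n nT Hh2 _ i1n.
  have /andP[dh0 dhH] := dtH _ i_n.
  have thB : `|theta| <= `|L1| * H.
    by rewrite (le_trans thL)// ler_wpM2r ?ler_norm// ltW.
  have L14 : `|L1| * H <= 4^-1.
    apply: le_trans (_ : (1 + `|L1|) * ht <= _).
      by rewrite ler_pM ?lerDr// ltW.
    by rewrite /ht invfM mulrCA mulfV ?mulr1// gt_eqF// ltr_pwDl.
  (* Slow variation controls dt_(i-1) / dt_i = 1 + theta, the inverse of the ratio on which Q and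
     the defect depend. *)
  have tauE : gratio (dt k) i.+1 = (1 + theta)^-1.
    by rewrite /gratio /= thE invfM mulrCA mulfV ?mulr1// gt_eqF.
  have tau1 : `|1 + theta - 1| = `|theta| by rewrite addrAC subrr add0r.
  rewrite -[X in _ <= X]mulrA (le_trans (NC _))// ler_wpM2l ?(ltW CN0)//.
  rewrite /peer_residual /peer_rhs tauE.
  apply: le_trans (resC (gtime (dt k) i.+1) (gtime (dt k) i) (dt k i.+1)
    (dt k i) (1 + theta) (wt i) (wt i.+1) _ _ thE _ _ _ _ _ _ _ _) _.
  - by rewrite dh0 (le_trans dhH).
  - by rewrite tau1 (le_trans thB).
  - by rewrite gtimeS addrK.
  - exact: domg.
  - exact: domg.
  - by apply: domx => //; [exact: gT | exact: dtH].
  - by apply: domx => //; [exact: gT | exact: dtH].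
  - move=> j js; apply: d_s => //; rewrite -tauE; apply: dt_ratio => //.
    by have /andP[] := gT _ i_n.
  - congr (_ - _); apply/matrixP => l p; rewrite !mxE gtimeS; congr (u _ _ _).
    by ring.
  - by [].
  have e1 : dt k i.+1 + `|theta| <= (1 + `|L1|) * H.
    by rewrite mulrDl mul1r lerD.
  have e2 : dt k i.+1 ^+ s <= H ^+ s by rewrite lerXn2r// ?nnegrE ltW.
  have e3 : 0 <= dt k i.+1 ^+ s by rewrite exprn_ge0// ltW.
  have dt0 := ltW dh0.
  rewrite tau1 -mulrA ler_wpM2l//.
  apply: le_trans (_ : H ^+ s * dt k i.+1 * ((1 + `|L1|) * H) <= _).
    rewrite exprSr; apply: ler_pM => //; rewrite ?mulr_ge0 ?addr_ge0//.
    by rewrite ler_wpM2r.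
  by rewrite exprSr le_eqVlt; apply/orP; left; apply/eqP; ring.
have rhosum : \sum_(1 <= i < n.+1) N (peer_residual F Pm Rm c (dt k) wt i)
    <= B2 * H ^+ s.+1.
  apply: le_trans (_ : \sum_(1 <= i < n.+1)
      CN * (C * (1 + `|L1|)) * (dt k i * H ^+ s.+1) <= _).
    by apply: ler_sum_nat => i; rewrite ltnS; apply: res.
  rewrite -mulr_sumr -mulr_suml /B2 -[leRHS]mulrA ler_wpM2l//.
    by rewrite mulr_ge0// ?mulr_ge0// ?ltW// addr_ge0.
  rewrite ler_wpM2r// (le_trans (sum_dt_le n dtk))// lerD//.
  by have /andP[_ /le_trans] := dtH n (leqnn n); apply.
have wt_close i : (i <= n)%N -> N (wt i - exact_stages u c (dt k) i) <= rho0.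
  by move=> i_n; rewrite /wt addrAC subrr add0r NN Zrho.
have wt0 : N (wt 0%N - w k 0%N) <= (B1 + `|L0|) * H ^+ s.+1.
  rewrite /wt addrAC mulrDl addrC (le_trans (NT _ _))// NN lerD ?ZB//.
  rewrite (le_trans (start k n nT Hh1))//.
  have /andP[d0 dH] := dtH 0%N isT.
  apply: le_trans (_ : `|L0| * dt k 0%N ^+ s.+1 <= _).
    by rewrite ler_wpM2r ?ler_norm// exprn_ge0// ltW.
  by rewrite ler_wpM2l// lerXn2r// ?nnegrE ltW.
have stabn := stab k n nT Hs wt wt_close.
have -> : global_error u c (dt k) (w k) n = (wt n - w k n) + Z n.
  by rewrite /global_error /wt addrAC subrK.
rewrite (le_trans (NT _ _))// mulrDl lerD ?ZB// (le_trans stabn)// -mulrA.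
apply: le_trans (ler_wpM2r _ (ler_norm K)) _.
  by rewrite addr_ge0 ?sumr_ge0// => *; apply: is_norm_ge0.
by rewrite ler_wpM2l// mulrDl lerD.
Qed.
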